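(* Fix $d\in\mathbb{N}$ and let $P\subseteq\mathbb{R}^d$ be a $d$-dimensional polytope. Let $L$ be the field extension of $\mathbb{Q}$ generated by the coordinates of the vertices of $P$, and let $g$ be the transcendence degree of $L$ over $\mathbb{Q}$. Then $\operatorname{xc}(P)\geq\sqrt{g}$.
   Context: The extension complexity $\operatorname{xc}(P)$ of a polytope $P$ is the minimum number of facets of a polytope $P'$ (in any dimension) such that $P$ is the image of $P'$ under a linear projection. *)

(* Defs.v *)
From HB Require Import structures.
From mathcomp Require Import all_boot all_order all_algebra.
From mathcomp Require Import finmap boolp classical_sets functions cardinality reals.
From mathcomp Require Import -(notations) mpoly.

Set Implicit Arguments.
Unset Strict Implicit.
Unset Printing Implicit Defensive.

Import Order.TTheory GRing.Theory Num.Theory.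

Local Open Scope classical_set_scope.
Local Open Scope ring_scope.

Definition conv_hull (R : realType) (n k : nat) (v : 'I_k -> 'rV[R]_n) :
    set 'rV[R]_n :=
  [set x | exists w : 'I_k -> R,
     [/\ forall i, 0 <= w i, \sum_i w i = 1 & x = \sum_i w i *: v i]].

(* The empty set is a polytope (k = 0). *)
Definition is_polytope (R : realType) (n : nat) (P : set 'rV[R]_n) : Prop :=
  exists (k : nat) (v : 'I_k -> 'rV[R]_n), P = conv_hull v.

Record polytope (R : realType) (n : nat) := Polytope {
  polytope_set :> set 'rV[R]_n;
  polytope_setP : is_polytope polytope_set
}.

Definition affinely_independent (R : realType) (n k : nat)
    (v : 'I_k -> 'rV[R]_n) : Prop :=
  forall c : 'I_k -> R,
    \sum_i c i = 0 -> \sum_i c i *: v i = 0 -> forall i, c i = 0.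

(* Affine dimension: the largest number of affinely independent points of S,
   minus one; in particular affdim set0 = -1.  The bound k < n.+2 loses nothing,
   since n.+2 points of R^n are always affinely dependent. *)
Definition affdim (R : realType) (n : nat) (S : set 'rV[R]_n) : int :=
  (\max_(k < n.+2 | `[< exists v : 'I_k -> 'rV[R]_n,
      (forall i, S (v i)) /\ affinely_independent v >]) k)%N%:Z - 1.

(* The zero functional gives the improper faces P (b = 0) and set0 (b = 1). *)
Definition is_face (R : realType) (n : nat) (P F : set 'rV[R]_n) : Prop :=
  exists (c : 'rV[R]_n) (b : R),
    (forall x, P x -> \sum_i c 0 i * x 0 i <= b) /\
    F = [set x | P x /\ \sum_i c 0 i * x 0 i = b].

Definition vertices (R : realType) (n : nat) (P : set 'rV[R]_n) :
    set 'rV[R]_n :=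
  [set v | is_face P [set v]].

Definition facets (R : realType) (n : nat) (P : set 'rV[R]_n) :
    set (set 'rV[R]_n) :=
  [set F | is_face P F /\ affdim F = affdim P - 1].

(* A polytope has finitely many faces, so the value that fset_set takes on
   infinite sets is never used. *)
Definition nb_facets (R : realType) (n : nat) (P : polytope R n) : nat :=
  #|` fset_set (facets P)|%fset.

Definition has_extension (R : realType) (n : nat) (P : polytope R n)
    (k : nat) : Prop :=
  exists (m : nat) (Q : polytope R m) (f : {linear 'rV[R]_m -> 'rV[R]_n}),
    f @` Q = P /\ nb_facets Q = k.

Lemma has_extension_ex (R : realType) (n : nat) (P : polytope R n) :
  exists k, `[< has_extension P k >].
Proof.
exists (nb_facets P); apply/asboolP; exists n, P, idfun; split=> //.
by rewrite image_id.
Qed.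

Definition xc (R : realType) (n : nat) (P : polytope R n) : nat :=
  ex_minn (has_extension_ex P).

(* The subfield of R generated by S; it contains the rationals. *)
Definition subfield_gen (R : realType) (S : set R) : set R :=
  smallest [set K : set R | divring_closed (mem K)] S.

(* mmap ratr t p is the value of the rational polynomial p at t. *)
Definition algebraically_independent (R : realType) (k : nat)
    (t : 'I_k -> R) : Prop :=
  forall p : mpoly k rat, p != 0 -> mmap ratr t p != 0.

Definition algebraic_over (R : realType) (K : set R) (x : R) : Prop :=
  exists p : {poly R}, [/\ p != 0, forall i, K p`_i & root p x].

Definition is_transcendence_basis (R : realType) (L : set R) (k : nat)
    (t : 'I_k -> R) : Prop :=
  [/\ forall i, L (t i),
      algebraically_independent t &
      forall x, L x -> algebraic_over (subfield_gen (range t)) x].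

(* All transcendence bases have the same cardinality, so g is determined by L. *)
Definition has_trdeg (R : realType) (L : set R) (g : nat) : Prop :=
  exists t : 'I_g -> R, is_transcendence_basis L t.

Definition vertex_field (R : realType) (n : nat) (P : set 'rV[R]_n) : set R :=
  subfield_gen [set v 0 i | v in vertices P & i in [set: 'I_n]].

(* Main.v *)
Require Import Defs.
From HB Require Import structures.
From mathcomp Require Import all_boot all_order all_algebra.
From mathcomp Require Import finmap boolp classical_sets functions cardinality reals.
From mathcomp Require Import -(notations) mpoly.
From mathcomp Require Import ring zify.

(* Let [P = f(Q)] where [Q] is a polytope with generators [v_i] and [k] facets,
   and let [S] be the slack matrix whose row [j] lists the values at the [v_i] of
   an affine functional defining the facet [j].  Every affine functional takes on
   the [v_i] values in the row space of [S]; if it vanishes on a face, it is a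
   combination of the facet functionals vanishing on this face.  Write the
   constant 1 and the coordinates of [f] as [A *m S], and let the rows of [B] be
   a basis of the linear relations between the rows of [S].  At a vertex [x] of
   [P], the coordinate [x_a] is the only scalar such that [f_a - x_a] is a
   combination of the facet functionals vanishing on the face above [x], which is
   a linear system with coefficients in [Q(A, B)]; hence this field contains [L].
   As [rank S >= d + 1], the matrices [A] and [B] have together at most
   [(d + 1) + (k - rank S) <= k] rows of length [k], so [g <= k ^ 2]. *)

Set Implicit Arguments.
Unset Strict Implicit.
Unset Printing Implicit Defensive.

Import Order.TTheory GRing.Theory Num.Theory.

Local Open Scope ring_scope.

(** * Values of rational functions *)

(** [mmeasure mdeg p] is the degree plus one, and 0 for [p = 0]; a bound by [a.+1] thus reads as
    degree at most [a] and also covers the zero polynomial. *)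
Lemma msizeM_leS (R : idomainType) (n a b : nat) (p q : mpoly n R) :
  (mmeasure mdeg p <= a.+1)%N -> (mmeasure mdeg q <= b.+1)%N ->
  (mmeasure mdeg (p * q) <= (a + b).+1)%N.
Proof.
have [->|p0] := eqVneq p 0; first by rewrite mul0r mmeasure0.
have [->|q0] := eqVneq q 0; first by rewrite mulr0 mmeasure0.
by rewrite msizeM //; lia.
Qed.

Lemma msizeX_leS (R : idomainType) (n a k : nat) (p : mpoly n R) :
  (mmeasure mdeg p <= a.+1)%N -> (mmeasure mdeg (p ^+ k) <= (k * a).+1)%N.
Proof.
move=> pa; elim: k => [|k IH]; first by rewrite expr0 msize1.
by rewrite exprS mulSn msizeM_leS.
Qed.

Lemma msize_prod_leS (R : idomainType) (n a k : nat) (p : 'I_k -> mpoly n R) :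
  (forall i, mmeasure mdeg (p i) <= a.+1)%N ->
  (mmeasure mdeg (\prod_i p i) <= (k * a).+1)%N.
Proof.
elim: k p => [|k IH] p pa; first by rewrite big_ord0 msize1.
by rewrite big_ord_recl mulSn msizeM_leS // IH.
Qed.

(** The exponents of degree at most [M] lie in a box of [M.+1 ^ n] points, so the coefficient matrix
    has more rows than columns and a nonzero left kernel. *)
Lemma mpoly_lin_dep (F : fieldType) (n M : nat) (I : finType) (p : I -> mpoly n F) :
  (forall i, mmeasure mdeg (p i) <= M.+1)%N -> (M.+1 ^ n < #|I|)%N ->
  exists2 c : I -> F, exists i, c i != 0 & \sum_i c i *: p i = 0.
Proof.
move=> pM lt_nI; pose J := {ffun 'I_n -> 'I_M.+1}.
have cJ : #|{: J}| = (M.+1 ^ n)%N by rewrite card_ffun !card_ord.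
pose mon (x : J) := Multinom [tuple (x k : nat) | k < n].
pose A := \matrix_(i < #|I|, j < #|{: J}|) mcoeff (mon (enum_val j)) (p (enum_val i)).
have : kermx A != 0.
  by rewrite kermx_eq0 /row_free neq_ltn (leq_ltn_trans (rank_leq_col A)) // cJ.
case/rowV0Pn => v /sub_kermxP vA v0.
exists (fun i => v 0 (enum_rank i)).
  by have /rV0Pn[k vk] := v0; exists (enum_val k); rewrite enum_valK.
apply/mpolyP => m; rewrite mcoeff0 raddf_sum /=.
have [mM|mM] := leqP (mdeg m) M; last first.
  by rewrite big1 // => i _; rewrite mcoeffZ memN_msupp_eq0 ?mulr0 //
     msize_mdeg_ge // (leq_trans (pM i)).
have mk k : (m k < M.+1)%N.
  by rewrite ltnS (leq_trans _ mM) // mdegE (bigD1 k) //= leq_addr.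
pose x : J := [ffun k => Ordinal (mk k)].
have emx : mon x = m by apply/mnmP => k; rewrite mnmE ffunE.
have := congr1 (fun B : 'rV_ _ => B 0 (enum_rank x)) vA.
rewrite !mxE => e0; rewrite -[RHS]e0 (reindex (@enum_val I predT)) /=; last first.
  by apply: onW_bij; apply: enum_val_bij.
apply: eq_bigr => i _.
by rewrite mcoeffZ mxE enum_rankK enum_valK emx.
Qed.

(** The field $\mathbb{Q}(s)$ as explicit fractions: membership hands over the numerator and the
    denominator on which degrees are counted. *)
Definition ratfun_values (R : realType) (n : nat) (s : 'I_n -> R) : set R :=
  [set x | exists p q : mpoly n rat,
     mmap ratr s q != 0 /\ x = mmap ratr s p / mmap ratr s q].

Lemma ratfun_values_divring (R : realType) (n : nat) (s : 'I_n -> R) :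
  divring_closed (mem (ratfun_values s)).
Proof.
split.
- by rewrite in_setE; exists 1, 1; rewrite rmorph1 oner_eq0 divr1.
- move=> x y; rewrite !in_setE => -[p [q [q0 ->]]] [p' [q' [q0' ->]]].
  exists (p * q' - p' * q), (q * q'); rewrite rmorphB !rmorphM; split.
    by rewrite mulf_neq0.
  by field; rewrite q0 q0'.
- move=> x y; rewrite !in_setE => -[p [q [q0 ->]]] [p' [q' [q0' ->]]].
  have [e0|p0] := eqVneq (mmap ratr s p') 0.
    by exists 0, 1; rewrite rmorph0 rmorph1 oner_eq0 e0 mul0r invr0 mulr0 mul0r.
  exists (p * q'), (q * p'); rewrite !rmorphM; split.
    by rewrite mulf_neq0.
  by field; rewrite q0 q0' p0.
Qed.

Definition ratfun_pred (R : realType) (n : nat) (s : 'I_n -> R) : R -> bool :=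
  fun x => x \in ratfun_values s.

HB.instance Definition _ (R : realType) (n : nat) (s : 'I_n -> R) :=
  GRing.isDivringClosed.Build R (ratfun_pred s) (ratfun_values_divring s).

Lemma ratfun_values_gen (R : realType) (n : nat) (s : 'I_n -> R) (i : 'I_n) :
  ratfun_values s (s i).
Proof.
exists (mpolyX rat (mnm1 i)), 1.
by rewrite mmapX mmap1U rmorph1 oner_eq0 divr1.
Qed.

Lemma algebraically_independent_monomials (R : realType) (g D : nat)
    (t : 'I_g -> R) (c : {ffun 'I_g -> 'I_D} -> rat) :
  algebraically_independent t ->
  \sum_a ratr (c a) * \prod_i t i ^+ a i = 0 -> forall a, c a = 0.
Proof.
move=> tindep sum0 a; apply/eqP/negP => /negP ca.
pose mon (x : {ffun 'I_g -> 'I_D}) := Multinom [tuple (x k : nat) | k < g].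
have mon_inj : injective mon.
  move=> x y exy; apply/ffunP => k; apply/val_inj.
  by have /mnmP/(_ k) := exy; rewrite !mnmE.
have := tindep (\sum_x c x *: mpolyX rat (mon x)).
have -> : mmap ratr t (\sum_x c x *: mpolyX rat (mon x)) = 0.
  rewrite -[RHS]sum0 raddf_sum; apply: eq_bigr => x _ /=.
  rewrite mmapZ mmapX; congr (_ * _); apply: eq_bigr => i _.
  by rewrite mnmE.
rewrite eqxx => contra; suff /contra : \sum_x c x *: mpolyX rat (mon x) != 0 by [].
apply/eqP => /(congr1 (mcoeff (mon a))).
rewrite mcoeff0 raddf_sum (bigD1 a) //= big1 => [|x xa]; last first.
  by rewrite mcoeffZ mcoeffX (inj_eq mon_inj) (negbTE xa) mulr0.
rewrite mcoeffZ mcoeffX eqxx mulr1 addr0 => c0.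
by rewrite c0 eqxx in ca.
Qed.

(* With a common denominator [q], the [D ^ g] monomials in [t] of partial
   degrees [< D], multiplied by [q(s) ^ (g (D - 1))], are values at [s] of
   polynomials of degree O(D), which span a space of dimension O(D ^ n). *)
Lemma algebraically_independent_leq (R : realType) (g n : nat)
    (t : 'I_g -> R) (s : 'I_n -> R) :
  algebraically_independent t -> (forall i, ratfun_values s (t i)) ->
  (g <= n)%N.
Proof.
move=> tindep st; rewrite leqNgt; apply/negP => lt_ng.
have [p /choice[q0 pqP]] := choice st.
pose q := \prod_j q0 j.
pose P i := p i * \prod_(j | j != i) q0 j.
have qs0 : mmap ratr s q != 0.
  by rewrite rmorph_prod; apply/prodf_neq0 => j _; case: (pqP j).
have Ps i : mmap ratr s (P i) = mmap ratr s q * t i.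
  have [q0i ->] := pqP i.
  by rewrite /P /q [\prod_j q0 j](bigD1 i) //= !rmorphM; field.
pose M := (mmeasure mdeg q + \sum_i mmeasure mdeg (P i))%N.
have qM : (mmeasure mdeg q <= M.+1)%N by rewrite /M; lia.
have PM i : (mmeasure mdeg (P i) <= M.+1)%N.
  by rewrite /M (bigD1 i) //=; lia.
(* The [D.+1 ^ g >= D.+1 ^ n.+1] products must outnumber [(g * (D * M)).+1 ^ n], which is at most
   [(g * M).+1 ^ n * D.+1 ^ n]; it suffices that [D.+1] exceeds [(g * M).+1 ^ n]. *)
pose D := ((g * M).+1 ^ n)%N.
pose Phi (a : {ffun 'I_g -> 'I_D.+1}) :=
  \prod_i (P i ^+ a i * q ^+ (D - a i)).
have PhiM a : (mmeasure mdeg (Phi a) <= (g * (D * M)).+1)%N.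
  apply: msize_prod_leS => i.
  have -> : (D * M = a i * M + (D - a i) * M)%N.
    by rewrite -mulnDl subnKC // -ltnS.
  by rewrite msizeM_leS ?msizeX_leS.
have [|c [a ca] sum0] := mpoly_lin_dep PhiM.
  rewrite card_ffun !card_ord.
  apply: (@leq_trans (D.+1 ^ n.+1)); last by rewrite leq_pexp2l.
  apply: (@leq_ltn_trans ((g * M).+1 ^ n * D.+1 ^ n)).
    have leX a b k : (a <= b)%N -> (a ^ k <= b ^ k)%N.
      by case: k => // k le_ab; rewrite leq_exp2r.
    by rewrite -expnMn leX //; nia.
  by rewrite expnS ltn_pmul2r // expn_gt0.
move/eqP: ca; apply.
apply: (algebraically_independent_monomials (c := c) tindep).
have qD0 : (mmap ratr s q ^+ D) ^+ g != 0 by rewrite !expf_neq0.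
apply/(mulfI qD0); rewrite mulr0.
transitivity (mmap ratr s (\sum_x c x *: Phi x)); last by rewrite sum0 rmorph0.
rewrite mulr_sumr raddf_sum.
apply: eq_bigr => x _; rewrite /= mmapZ mulrCA; congr (_ * _).
rewrite [RHS]rmorph_prod -[X in _ ^+ X]card_ord -prodr_const -big_split.
apply: eq_bigr => i _ /=; rewrite rmorphM !rmorphXn /= Ps exprMn mulrAC -exprD.
by rewrite subnKC // -ltnS.
Qed.

(** * Linear systems over a subfield *)

Definition subfield_of (F : fieldType) (K : divringClosed F) := {x : F | x \in K}.

HB.instance Definition _ (F : fieldType) (K : divringClosed F) :=
  SubType.copy (subfield_of K) {x : F | x \in K}.
HB.instance Definition _ (F : fieldType) (K : divringClosed F) :=
  [Choice of subfield_of K by <:].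
HB.instance Definition _ (F : fieldType) (K : divringClosed F) :=
  [SubChoice_isSubIntegralDomain of subfield_of K by <:].
HB.instance Definition _ (F : fieldType) (K : divringClosed F) :=
  [SubIntegralDomain_isSubField of subfield_of K by <:].

Lemma map_val_subfieldP (F : fieldType) (K : divringClosed F) (m n : nat)
    (A : 'M[F]_(m, n)) :
  (forall i j, A i j \in K) -> exists B : 'M[subfield_of K]_(m, n), A = map_mx val B.
Proof.
move=> KA; exists (\matrix_(i, j) (exist _ (A i j) (KA i j) : subfield_of K)).
by apply/matrixP => i j; rewrite !mxE.
Qed.

(** The pseudo-inverse commutes with field embeddings, so the solution [b *m pinvmx A] has its
    entries in [K]. *)
Lemma submx_subfield_sol (F : fieldType) (K : divringClosed F) (m n : nat)
    (b : 'rV[F]_n) (A : 'M[F]_(m, n)) :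
  (forall j, b 0 j \in K) -> (forall i j, A i j \in K) -> (b <= A)%MS ->
  exists2 z : 'rV[F]_m, (forall i, z 0 i \in K) & z *m A = b.
Proof.
move=> Kb KA bA; exists (b *m pinvmx A); last exact: mulmxKpV.
have [|b' eb] := @map_val_subfieldP F K _ _ b.
  by move=> i j; rewrite ord1.
have [//|A' eA] := @map_val_subfieldP F K _ _ A.
by move=> i; rewrite eA eb -map_pinvmx -map_mxM mxE; exact: valP.
Qed.

(** * Decomposition into facet functionals *)

(* When the columns of [M] are the vectors (1, v_i), the row space of [M] consists
   of the lists of values at the [v_i] of affine functionals, and [l] is a facet
   vector iff it is the slack vector of a facet of the convex hull. *)
Definition facet_vector (F : realFieldType) (n r : nat) (M : 'M[F]_(n, r))
    (l : 'rV[F]_r) : Prop :=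
  [/\ (l <= M)%MS, l != 0, forall i, 0 <= l 0 i &
      forall h : 'rV[F]_r, (h <= M)%MS ->
        (forall i, l 0 i = 0 -> h 0 i = 0) -> (h <= l)%MS].

(** For [y] the slack vector of a face, this means that [h] vanishes at the generators on that
    face. *)
Definition zeros_sub (F : realFieldType) (r : nat) (y h : 'rV[F]_r) : Prop :=
  forall i, y 0 i = 0 -> h 0 i = 0.

Definition supp (F : realFieldType) (r : nat) (y : 'rV[F]_r) : {set 'I_r} :=
  [set i | y 0 i != 0].

(** Take for [s] the least ratio [h_i / y_i] over the support of [y]: nonnegativity holds by
    minimality, and the index attaining the minimum leaves the support. *)
Lemma shift_nonneg (F : realFieldType) (r : nat) (y h : 'rV[F]_r) :
  (forall i, 0 <= y 0 i) -> y != 0 -> zeros_sub y h ->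
  exists s, [/\ forall i, 0 <= (h - s *: y) 0 i, zeros_sub y (h - s *: y) &
    (#|supp (h - s *: y)| < #|supp y|)%N].
Proof.
move=> y_ge0 /rV0Pn[i0 yi0] yh.
have [j yj jmin] :=
  @arg_minP _ F 'I_r i0 (fun i => y 0 i != 0) (fun i => h 0 i / y 0 i) yi0.
exists (h 0 j / y 0 j); have sub : zeros_sub y (h - (h 0 j / y 0 j) *: y).
  by move=> i yi; rewrite !mxE yi (yh i yi) mulr0 subr0.
split=> //.
- move=> i; have [yi|yi] := eqVneq (y 0 i) 0; first by rewrite sub.
  by rewrite !mxE subr_ge0 -ler_pdivlMr ?jmin // lt_def yi y_ge0.
- apply/proper_card/properP; split.
    by apply/fintype.subsetP => i; rewrite !inE; apply: contra => /eqP/sub ->.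
  by exists j; rewrite !inE // !mxE divfK // subrr eqxx.
Qed.

(** When the rows of [S] are facet slacks, only facets containing the face of [y] may contribute.
    The coefficients have no prescribed sign, since only linear spans matter. *)
Definition facet_combination (F : realFieldType) (k r : nat) (S : 'M[F]_(k, r))
    (y h : 'rV[F]_r) : Prop :=
  exists2 mu : 'rV[F]_k, h = mu *m S &
    forall j, mu 0 j != 0 -> zeros_sub y (row j S).

Lemma facet_combinationD (F : realFieldType) (k r : nat) (S : 'M[F]_(k, r))
    (y h1 h2 : 'rV[F]_r) (c1 c2 : F) :
  facet_combination S y h1 -> facet_combination S y h2 ->
  facet_combination S y (c1 *: h1 + c2 *: h2).
Proof.
move=> [mu1 -> sub1] [mu2 -> sub2]; exists (c1 *: mu1 + c2 *: mu2).
  by rewrite mulmxDl !scalemxAl.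
move=> j; rewrite !mxE; have [e1|/sub1 //] := eqVneq (mu1 0 j) 0.
have [e2|/sub2 //] := eqVneq (mu2 0 j) 0.
by rewrite e1 e2 !mulr0 addr0 eqxx.
Qed.

Lemma facet_combination_weaken (F : realFieldType) (k r : nat) (S : 'M[F]_(k, r))
    (y y' h : 'rV[F]_r) :
  zeros_sub y y' -> facet_combination S y' h -> facet_combination S y h.
Proof.
by move=> yy' [mu -> sub]; exists mu => // j muj i /yy'; exact: sub.
Qed.

(** A facet determines its slack vector only up to a factor, so [l] need only be a multiple of a
    row. *)
Definition covers_facets (F : realFieldType) (n k r : nat) (M : 'M[F]_(n, r))
    (S : 'M[F]_(k, r)) : Prop :=
  forall l, facet_vector M l ->
    exists2 j, (l <= row j S)%MS & zeros_sub l (row j S).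

(* A nonnegative [y] that is not a facet vector is, up to a positive factor, the
   sum of two nonnegative vectors [h - s y] and [- h - s' y] of smaller support. *)
Lemma nonneg_facet_combination (F : realFieldType) (n k r : nat)
    (M : 'M[F]_(n, r)) (S : 'M[F]_(k, r)) (y : 'rV[F]_r) :
  covers_facets M S -> (y <= M)%MS -> (forall i, 0 <= y 0 i) ->
  facet_combination S y y.
Proof.
move=> MS; move: {2}_.+1 (ltnSn #|supp y|) => N.
elim: N y => // N IH y leN yM y_ge0.
have [->|y0] := eqVneq y 0.
  by exists 0; rewrite ?mul0mx // => j; rewrite mxE eqxx.
have [yF|/existsNP[h]] := pselect (forall h : 'rV[F]_r, (h <= M)%MS ->
    zeros_sub y h -> (h <= y)%MS).
  have [//|j /sub_rVP[c ey] sub] := MS y.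
  exists (c *: delta_mx 0 j); first by rewrite -scalemxAl -rowE.
  move=> j'; rewrite !mxE eqxx /=; have [->|_] := eqVneq j' j.
    by move=> _ i yi; apply: sub.
  by rewrite mulr0 eqxx.
move=> /not_implyP[hM /not_implyP[yh hy]].
have [s [a_ge0 ya lta]] := shift_nonneg y_ge0 y0 yh.
have yNh : zeros_sub y (- h) by move=> i /yh; rewrite mxE => ->; rewrite oppr0.
have [s' [b_ge0 yb ltb]] := shift_nonneg y_ge0 y0 yNh.
set a := h - s *: y in a_ge0 ya lta; set b := - h - s' *: y in b_ge0 yb ltb.
have ab : a + b = - (s + s') *: y.
  by rewrite /a /b; apply/rowP => i; rewrite !mxE; ring.
(* Otherwise the nonnegative vectors [a] and [b] have sum 0, so [a = 0] and [h = s y], against the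
   choice of [h]. *)
have ss0 : s + s' != 0.
  apply/eqP => ss; case: hy; apply/sub_rVP; exists s.
  apply/eqP; rewrite -subr_eq0 -/a; apply/eqP/rowP => i; rewrite [RHS]mxE.
  have := congr1 (fun B : 'rV_ _ => B 0 i) ab.
  rewrite ss oppr0 scale0r mxE [in RHS]mxE => /eqP.
    by rewrite paddr_eq0 // => /andP[/eqP].
have {2}-> : y = (- (s + s'))^-1 *: a + (- (s + s'))^-1 *: b.
  by rewrite -scalerDr ab scalerA mulVf ?scale1r // oppr_eq0.
have IH' z : zeros_sub y z -> (#|supp z| < #|supp y|)%N ->
    (z <= M)%MS -> (forall i, 0 <= z 0 i) -> facet_combination S y z.
  move=> yz ltz zM z_ge0; apply: (facet_combination_weaken yz); apply: IH => //.
  exact: leq_trans ltz leN.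
by apply: facet_combinationD; apply: IH' => //;
  rewrite addmx_sub ?eqmx_opp // scalemx_sub.
Qed.

(** Write [h] as [(h - s y) + s y] with [h - s y] nonnegative and still zero on the face: the
    nonnegative case applies to [h - s y] and to [y]. *)
Lemma face_facet_combination (F : realFieldType) (n k r : nat)
    (M : 'M[F]_(n, r)) (S : 'M[F]_(k, r)) (y h : 'rV[F]_r) :
  covers_facets M S -> (y <= M)%MS -> (forall i, 0 <= y 0 i) ->
  (h <= M)%MS -> zeros_sub y h -> facet_combination S y h.
Proof.
move=> MS yM y_ge0 hM yh; have [y0|y0] := eqVneq y 0.
  exists 0; last by move=> j; rewrite mxE eqxx.
  by apply/rowP => i; rewrite mul0mx [RHS]mxE yh // y0 mxE.
have [s [a_ge0 ya _]] := shift_nonneg y_ge0 y0 yh.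
have -> : h = 1 *: (h - s *: y) + s *: y by rewrite scale1r subrK.
apply: facet_combinationD; last exact: nonneg_facet_combination MS yM y_ge0.
apply: (facet_combination_weaken ya); apply: nonneg_facet_combination MS _ a_ge0.
by rewrite addmx_sub // eqmx_opp scalemx_sub.
Qed.

(** * Facets and slack vectors of a convex hull *)

(** Homogeneous coordinates: affine independence of points becomes linear independence of rows, and
    affine dimension becomes rank minus one. *)
Definition homog (R : realType) (m r : nat) (v : 'I_r -> 'rV[R]_m) :
    'M[R]_(r, 1 + m) :=
  \matrix_i row_mx (const_mx 1) (v i).

Lemma mul_homog (R : realType) (m r : nat) (v : 'I_r -> 'rV[R]_m) (c : 'rV[R]_r) :
  c *m homog v = row_mx (const_mx (\sum_i c 0 i)) (\sum_i c 0 i *: v i).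
Proof.
apply/rowP => j; rewrite mxE; case: (splitP j) => j' ej.
  have -> : j = lshift m j' by exact: val_inj.
  rewrite row_mxEl mxE; apply: eq_bigr => i _.
  by rewrite mxE row_mxEl mxE mulr1.
have -> : j = rshift 1 j' by exact: val_inj.
rewrite row_mxEr summxE; apply: eq_bigr => i _.
by rewrite !mxE (unsplitK (inr _)).
Qed.

Lemma affinely_independent_row_free (R : realType) (m r : nat)
    (v : 'I_r -> 'rV[R]_m) :
  affinely_independent v <-> row_free (homog v).
Proof.
split=> [ind|free c c0 cv0 i].
  rewrite -kermx_eq0; apply/rowV0P => c /sub_kermxP.
  rewrite mul_homog -row_mx0 => /eq_row_mx[/rowP/(_ 0) c0 cv0].
  by apply/rowP => i; rewrite mxE; apply: (ind (c 0)) => //; move: c0; rewrite !mxE.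
suff /rowP/(_ i) : \row_i c i = 0 by rewrite !mxE.
apply/eqP; rewrite -(mulmx_free_eq0 _ free) mul_homog; apply/eqP.
rewrite (eq_bigr c) => [|j _]; last by rewrite mxE.
rewrite [X in row_mx _ X](eq_bigr (fun j => c j *: v j)) => [|j _]; last by rewrite mxE.
by rewrite c0 cv0 -row_mx0; congr row_mx; apply/rowP => j; rewrite !mxE.
Qed.

Lemma affdim_homog (R : realType) (m r : nat) (T : set 'rV[R]_m)
    (v : 'I_r -> 'rV[R]_m) :
  (forall i, T (v i)) -> (forall x, T x -> (row_mx (const_mx 1) x <= homog v)%MS) ->
  affdim T = (\rank (homog v))%:Z - 1.
Proof.
move=> Tv Th; rewrite /affdim; congr (Posz _ - 1); apply/eqP.
rewrite eqn_leq; apply/andP; split.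
  apply/bigmax_leqP => k /asboolP[w [Tw /affinely_independent_row_free/eqP <-]].
  by apply/mxrankS/row_subP => i; rewrite rowK; exact: Th.
have lt_r : (\rank (homog v) < m.+2)%N by rewrite ltnS rank_leq_col.
pose f := maxrankfun (homog v).
apply: (@leq_trans (Ordinal lt_r)) => //.
apply: (@leq_bigmax_cond _ _ (fun k : 'I_m.+2 => nat_of_ord k) (Ordinal lt_r)).
apply/asboolP; exists (v \o f); split=> [i|]; first exact: Tv.
apply/affinely_independent_row_free.
suff -> : homog (v \o f) = rowsub f (homog v) by exact: maxrowsub_free.
by apply/matrixP => i j; rewrite !mxE.
Qed.

Lemma conv_hull_gen (R : realType) (m r : nat) (v : 'I_r -> 'rV[R]_m) (i : 'I_r) :
  conv_hull v (v i).
Proof.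
exists (fun j => (j == i)%:R); split=> [j||]; first exact: ler0n.
- by rewrite (bigD1 i) //= eqxx big1 ?addr0 // => j /negbTE->.
- by rewrite (bigD1 i) //= eqxx big1 ?scale1r ?addr0 // => j /negbTE->; rewrite scale0r.
Qed.

Lemma conv_hull_homog (R : realType) (m r : nat) (v : 'I_r -> 'rV[R]_m)
    (x : 'rV[R]_m) :
  conv_hull v x -> (row_mx (const_mx 1) x <= homog v)%MS.
Proof.
move=> [w [_ w1 ->]]; apply/submxP; exists (\row_i w i).
rewrite mul_homog; congr row_mx.
  by congr const_mx; rewrite -w1; apply: eq_bigr => i _; rewrite mxE.
by apply: eq_bigr => i _; rewrite mxE.
Qed.

Lemma affdim_conv_hull (R : realType) (m r : nat) (v : 'I_r -> 'rV[R]_m) :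
  affdim (conv_hull v) = (\rank (homog v))%:Z - 1.
Proof. by apply: affdim_homog; [exact: conv_hull_gen|exact: conv_hull_homog]. Qed.

Definition slack (R : realType) (m r : nat) (v : 'I_r -> 'rV[R]_m)
    (c : 'rV[R]_m) (b : R) : 'rV[R]_r :=
  \row_i (b - \sum_a c 0 a * v i 0 a).

Lemma slackE (R : realType) (m r : nat) (v : 'I_r -> 'rV[R]_m)
    (c : 'rV[R]_m) (b : R) :
  slack v c b = row_mx (const_mx b) (- c) *m (homog v)^T.
Proof.
have vE i j : (homog v)^T j i = row_mx (const_mx 1) (v i) 0 j by rewrite mxE mxE.
apply/rowP => i; rewrite [LHS]mxE [RHS]mxE big_split_ord big_ord1 /=.
rewrite vE !row_mxEl !mxE mulr1; congr (_ + _).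
rewrite -sumrN; apply: eq_bigr => a _.
by rewrite vE !row_mxEr mxE mulNr.
Qed.

Lemma slack_sub (R : realType) (m r : nat) (v : 'I_r -> 'rV[R]_m)
    (c : 'rV[R]_m) (b : R) : (slack v c b <= (homog v)^T)%MS.
Proof. by rewrite slackE submxMl. Qed.

Lemma sub_slack (R : realType) (m r : nat) (v : 'I_r -> 'rV[R]_m) (l : 'rV[R]_r) :
  (l <= (homog v)^T)%MS -> exists c b, l = slack v c b.
Proof.
move=> /submxP[D ->]; exists (- rsubmx D), (D 0 (lshift m 0)).
rewrite slackE opprK -[in LHS](hsubmxK D); congr (row_mx _ _ *m _).
by apply/rowP => j; rewrite !mxE ord1.
Qed.

Lemma conv_hull_slack (R : realType) (m r : nat) (v : 'I_r -> 'rV[R]_m)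
    (c : 'rV[R]_m) (b : R) (w : 'I_r -> R) :
  \sum_i w i = 1 ->
  b - \sum_a c 0 a * (\sum_i w i *: v i) 0 a = \sum_i w i * slack v c b 0 i.
Proof.
move=> w1.
have -> : \sum_a c 0 a * (\sum_i w i *: v i) 0 a
        = \sum_i w i * \sum_a c 0 a * v i 0 a.
  under eq_bigr => a _ do rewrite summxE mulr_sumr.
  rewrite exchange_big; apply: eq_bigr => i _ /=.
  by rewrite mulr_sumr; apply: eq_bigr => a _; rewrite mxE mulrCA.
under [RHS]eq_bigr => i _ do rewrite mxE mulrBr.
by rewrite sumrB -mulr_suml w1 mul1r.
Qed.

Definition sub_hull (R : realType) (m r : nat) (v : 'I_r -> 'rV[R]_m)
    (Z : {set 'I_r}) : set 'rV[R]_m :=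
  [set x | exists w : 'I_r -> R, [/\ forall i, 0 <= w i, \sum_i w i = 1,
     x = \sum_i w i *: v i & forall i, i \notin Z -> w i = 0]].

(** The slack of a convex combination is the weighted sum of the nonnegative slacks of the
    generators; it is 0 only if the weights sit on generators of slack 0. *)
Lemma face_sub_hull (R : realType) (m r : nat) (v : 'I_r -> 'rV[R]_m)
    (c : 'rV[R]_m) (b : R) :
  (forall x, conv_hull v x -> \sum_a c 0 a * x 0 a <= b) ->
  [set x | conv_hull v x /\ \sum_a c 0 a * x 0 a = b]%classic =
  sub_hull v [set i | slack v c b 0 i == 0].
Proof.
move=> cb; apply/seteqP; split=> x /=.
  move=> [[w [w0 w1 ->]] xb]; exists w; split=> // i; rewrite inE => si.
  have := conv_hull_slack v c b w1; rewrite xb subrr => /esym/eqP.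
  rewrite psumr_eq0 => [/allP/(_ i (mem_index_enum i))|j _].
    by rewrite /= mulf_eq0 (negbTE si) orbF => /eqP.
  by rewrite mulr_ge0 // mxE subr_ge0; apply/cb/conv_hull_gen.
move=> [w [w0 w1 -> wZ]]; split; first by exists w.
apply/eqP; rewrite eq_sym -subr_eq0 conv_hull_slack // big1 // => i _.
have [/eqP->|si] := boolP (slack v c b 0 i == 0); first by rewrite mulr0.
by rewrite wZ ?mul0r // inE.
Qed.

Lemma slack_ge0 (R : realType) (m r : nat) (v : 'I_r -> 'rV[R]_m)
    (c : 'rV[R]_m) (b : R) :
  (forall x, conv_hull v x -> \sum_a c 0 a * x 0 a <= b) <->
  forall i, 0 <= slack v c b 0 i.
Proof.
split=> [cb i|s_ge0 x [w [w0 w1 ->]]].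
  by rewrite mxE subr_ge0; apply/cb/conv_hull_gen.
by rewrite -subr_ge0 conv_hull_slack // sumr_ge0 // => i _; rewrite mulr_ge0.
Qed.

Lemma finite_facets (R : realType) (m r : nat) (v : 'I_r -> 'rV[R]_m) :
  finite_set (facets (conv_hull v)).
Proof.
apply: (@sub_finite_set _ _ (sub_hull v @` [set: {set 'I_r}])%classic).
  move=> F [[c [b [cb ->]]] _] /=.
  by exists [set i | slack v c b 0 i == 0] => //; rewrite face_sub_hull.
by apply: finite_image; exact: finite_finset.
Qed.

(** Restrict the row space of [(homog v)^T] to the columns in [Z], the generators on the face. By
    the last condition on facet vectors, the kernel of this restriction is the line of [l], so the
    rank drops by exactly one. *)
Lemma facet_of_vector (R : realType) (m r : nat) (v : 'I_r -> 'rV[R]_m)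
    (c : 'rV[R]_m) (b : R) :
  facet_vector (homog v)^T (slack v c b) ->
  facets (conv_hull v) [set x | conv_hull v x /\ \sum_a c 0 a * x 0 a = b]%classic.
Proof.
set l := slack v c b => -[lM l0 l_ge0 lF].
have cb := (slack_ge0 v c b).2 l_ge0.
split; first by exists c, b.
rewrite face_sub_hull // affdim_conv_hull -/l.
set Z := [set i | _]; pose vZ (k : 'I_#|Z|) := v (enum_val k).
have vZhull k : sub_hull v Z (vZ k).
  have := enum_valP k; rewrite inE => lk.
  rewrite /Z -face_sub_hull //=; split; first exact: conv_hull_gen.
  by apply/eqP; move: lk; rewrite mxE subr_eq0 eq_sym.
rewrite (affdim_homog vZhull) => [|x [w [w0 w1 -> wZ]]]; last first.
  have := (@conv_hull_homog _ _ _ vZ).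
  apply; exists (fun k => w (enum_val k)); split=> //.
    rewrite -w1 (bigID (mem Z)) /= [X in _ + X]big1 // addr0.
    by rewrite [RHS]big_enum_val.
  rewrite (bigID (mem Z)) /= [X in _ + X]big1 ?addr0 => [|i /wZ->].
    by rewrite big_enum_val.
  by rewrite scale0r.
suff -> : \rank (homog v) = (\rank (homog vZ)).+1 by rewrite intS [1 + _]addrC addrK.
pose B : 'M[R]_(r, #|Z|) := \matrix_(i, k) (i == enum_val k)%:R.
have mulB n (h : 'M[R]_(n, r)) : h *m B = \matrix_(i, k) h i (enum_val k).
  apply/matrixP => i k; rewrite !mxE (bigD1 (enum_val k)) //= mxE eqxx mulr1.
  by rewrite big1 ?addr0 // => j /negbTE jk; rewrite mxE jk mulr0.
rewrite -[LHS]mxrank_tr -(mxrank_mul_ker _ B) mulB.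
have -> : \matrix_(i, k) (homog v)^T i (enum_val k) = (homog vZ)^T.
  by apply/matrixP => i k; rewrite !mxE.
suff /eqmxP : ((homog v)^T :&: kermx B == l)%MS.
  by move=> ->; rewrite mxrank_tr rank_rV l0 addn1.
apply/andP; split.
  apply/rV_subP => h; rewrite sub_capmx => /andP[hM /sub_kermxP].
  rewrite mulB => /rowP hB; apply: lF => // i /eqP li.
  have iZ : i \in Z by rewrite inE.
  by have := hB (enum_rank_in iZ i); rewrite !mxE enum_rankK_in.
rewrite sub_capmx lM; apply/sub_kermxP; rewrite mulB; apply/rowP => k.
by have := enum_valP k; rewrite inE !mxE => /eqP.
Qed.

(** Choose one functional per facet. A facet vector [l] defines some facet of the list, and the row
    chosen for it has the same zeros as [l]; hence this row is a multiple of [l], with a nonzero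
    factor because [l] is nonzero. *)
Lemma facet_slack_matrix (R : realType) (m r : nat) (Q : polytope R m)
    (v : 'I_r -> 'rV[R]_m) :
  polytope_set Q = conv_hull v ->
  exists2 S : 'M[R]_(nb_facets Q, r), (S <= (homog v)^T)%MS &
    covers_facets (homog v)^T S.
Proof.
move=> Qv; rewrite /nb_facets.
have finQ : finite_set (facets Q) by rewrite Qv; exact: finite_facets.
set Fs := fset_set _.
pose F (j : 'I_(#|` Fs|)%fset) : set 'rV[R]_m := nth set0 (enum_fset Fs) j.
have FP j : exists cb : 'rV[R]_m * R,
    (forall x, conv_hull v x -> \sum_a cb.1 0 a * x 0 a <= cb.2) /\
    F j = [set x | conv_hull v x /\ \sum_a cb.1 0 a * x 0 a = cb.2]%classic.
  have : F j \in Fs by exact: mem_nth.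
  rewrite in_fset_set // inE => -[[c [b]]]; rewrite Qv => -[cb FE] _.
  by exists (c, b).
have [cb cbP] := choice FP.
have slackF j i : (slack v (cb j).1 (cb j).2 0 i == 0) <-> F j (v i).
  rewrite (cbP j).2 /= mxE subr_eq0 eq_sym; split=> [/eqP|[_ ->] //].
  by split=> //; exact: conv_hull_gen.
exists (\matrix_j slack v (cb j).1 (cb j).2).
  by apply/row_subP => j; rewrite rowK slack_sub.
move=> l lF; have [lM l0 l_ge0 lmin] := lF.
have [c [b el]] := sub_slack lM; rewrite el in lF.
have := facet_of_vector lF.
set G := [set x | _]%classic => GF.
have GFs : G \in Fs by rewrite in_fset_set // inE Qv.
have ltG : (index G (enum_fset Fs) < #|` Fs|)%N by rewrite index_mem.
pose j : 'I_(#|` Fs|)%fset := Ordinal ltG.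
have Fj : F j = G by rewrite /F nth_index.
have lE i : (l 0 i == 0) <-> G (v i).
  rewrite el /G /= mxE subr_eq0 eq_sym; split=> [/eqP|[_ ->] //].
  by split=> //; exact: conv_hull_gen.
have lj i : l 0 i = 0 <-> slack v (cb j).1 (cb j).2 0 i = 0.
  by split=> /eqP e; apply/eqP; [apply/slackF; rewrite Fj|];
     apply/lE => //; rewrite -Fj; apply/slackF.
exists j; rewrite rowK; last by move=> i /lj.
have /sub_rVP[a ea] : (slack v (cb j).1 (cb j).2 <= l)%MS.
  by apply: lmin; [exact: slack_sub|move=> i /lj].
have a0 : a != 0.
  apply: contra_neq l0 => a0; apply/rowP => i; rewrite [RHS]mxE.
  by apply/lj; rewrite ea a0 scale0r mxE.
by rewrite ea eqmx_scale.
Qed.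

(** * The vertex field of a projection *)

(** [a1 - v a0 - mu] is a relation between the rows of [S], hence a combination of the rows of [B].
    Erasing the coordinates where [mu] may be nonzero leaves a linear system over [K] solved by [v]
    and the coefficients of this combination. *)
Lemma face_value_subfield (F : realFieldType) (K : divringClosed F)
    (k r q : nat) (S : 'M[F]_(k, r)) (a0 a1 : 'rV[F]_k) (B : 'M[F]_(q, k))
    (y : 'rV[F]_r) (v : F) (i : 'I_r) :
  (kermx S <= B)%MS -> B *m S = 0 ->
  (forall t j, B t j \in K) -> (forall j, a0 0 j \in K) ->
  (forall j, a1 0 j \in K) ->
  facet_combination S y (a1 *m S - v *: (a0 *m S)) ->
  y 0 i = 0 -> (a0 *m S) 0 i = 1 -> (a1 *m S) 0 i = v -> v \in K.
Proof.
move=> kerB BS KB Ka0 Ka1 [mu muS muy] yi a0i a1i.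
(* [J] selects the rows of [S] that do not vanish on the face of [y]; [mu] is zero there, and [D]
   has entries 0 and 1, so the system stays over [K]. *)
pose J : pred 'I_k := fun j => [exists i', (y 0 i' == 0) && (S j i' != 0)].
pose D : 'M[F]_k := diag_mx (\row_j (J j)%:R).
have mulD n (A : 'M[F]_(n, k)) t j : (A *m D) t j = A t j * (J j)%:R.
  by rewrite mul_mx_diag !mxE.
have D_S (w : 'rV[F]_k) : w *m D = 0 -> (w *m S) 0 i = 0.
  move=> wD; rewrite mxE big1 // => j _.
  have := congr1 (fun A : 'rV_k => A 0 j) wD; rewrite mulD !mxE.
  have [|/existsPn/(_ i)] := boolP (J j); first by rewrite mulr1 => _ ->; rewrite mul0r.
  by rewrite yi eqxx negbK /= => /eqP->; rewrite mulr0.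
have muD : mu *m D = 0.
  apply/rowP => j; rewrite mulD mxE.
  have [/existsP[i' /andP[/eqP yi' Sj]]|_] := boolP (J j); last by rewrite mulr0.
  have [->|muj] := eqVneq (mu 0 j) 0; first by rewrite mul0r.
  by have := muy j muj i' yi'; rewrite mxE => e; rewrite e eqxx in Sj.
have /submxP[z ez] : (a1 - v *: a0 - mu <= B)%MS.
  apply: submx_trans kerB; apply/sub_kermxP.
  by rewrite !mulmxBl -scalemxAl -muS subrr.
have [|||x Kx ex] := @submx_subfield_sol F K _ _ (a1 *m D) (col_mx a0 B *m D).
- by move=> j; rewrite mulD rpredM // rpred_nat.
- move=> t j; rewrite mulD rpredM ?rpred_nat // mxE.
  by case: (fintype.split t) => // t'; rewrite (ord1 t').
- apply/submxP; exists (row_mx v%:M z).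
  rewrite mulmxA mul_row_col mul_scalar_mx -ez.
  by rewrite addrC -addrA [- mu + _]addrC addrA subrK mulmxBl muD subr0.
(* The solution over [K] may differ from the known one, but not in its first coordinate: evaluation
   at [i] kills the erased rows and the relations, and leaves [v - x_0 = 0]. *)
suff -> : v = x 0 (lshift q 0) by exact: Kx.
have : (a1 - x *m col_mx a0 B) *m D = 0.
  by rewrite mulmxBl -mulmxA ex subrr.
move/D_S; rewrite -[X in X *m col_mx _ _]hsubmxK mul_row_col mulmxBl
  mulmxDl -!mulmxA BS mulmx0 addr0.
have -> : lsubmx x = (x 0 (lshift q 0))%:M.
  by apply/matrixP => s t; rewrite !mxE !ord1 eqxx.
by rewrite mul_scalar_mx mxE a1i [X in _ + X]mxE [X in _ - X]mxE a0i
  mulr1 => /eqP; rewrite subr_eq0 => /eqP.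
Qed.

Lemma conv_hull_image (R : realType) (m n r : nat) (v : 'I_r -> 'rV[R]_m)
    (f : {linear 'rV[R]_m -> 'rV[R]_n}) :
  (f @` conv_hull v)%classic = conv_hull (f \o v).
Proof.
have fE w : f (\sum_i w i *: v i) = \sum_i w i *: (f \o v) i.
  by rewrite linear_sum; apply: eq_bigr => i _; rewrite linearZ.
apply/seteqP; split=> y /=.
  by move=> [x [w [w0 w1 ->]] <-]; exists w.
by move=> [w [w0 w1 ->]]; exists (\sum_i w i *: v i) => //; exists w.
Qed.

Lemma homog_image_sub (R : realType) (m n r : nat) (v : 'I_r -> 'rV[R]_m)
    (f : {linear 'rV[R]_m -> 'rV[R]_n}) :
  ((homog (f \o v))^T <= (homog v)^T)%MS.
Proof.
apply/submxP; exists (block_mx 1%:M 0 0 (lin1_mx f))^T.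
rewrite -trmx_mul; congr trmx; apply/row_matrixP => i.
rewrite row_mul !rowK mul_row_block !mulmx0 mulmx1 addr0 add0r.
by rewrite mul_rV_lin1.
Qed.

Lemma vertex_slack (R : realType) (n r : nat) (v : 'I_r -> 'rV[R]_n)
    (x : 'rV[R]_n) :
  vertices (conv_hull v) x ->
  exists c b, [/\ forall i, 0 <= slack v c b 0 i,
    forall i, slack v c b 0 i = 0 -> v i = x & exists i, slack v c b 0 i = 0].
Proof.
move=> [c [b [cb xE]]]; exists c, b.
split; first exact/slack_ge0.
- move=> i /eqP; rewrite mxE subr_eq0 eq_sym => /eqP si.
  have : [set x]%classic (v i) by rewrite xE /=; split=> //; exact: conv_hull_gen.
  by [].
(* Some generator lies on the face: otherwise all weights of [x] would be 0, while their sum is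
   1. *)
- have : [set x]%classic x by [].
  rewrite xE face_sub_hull // => -[w [_ w1 _ wZ]].
  have [/existsP[i /eqP si]|/existsPn sN] := boolP [exists i, slack v c b 0 i == 0].
    by exists i.
  have := oner_neq0 R; rewrite -w1 big1 ?eqxx // => i _.
  by apply: wZ; rewrite inE sN.
Qed.

Lemma extension_vertex_field (R : realType) (d k : nat) (P : polytope R d) :
  affdim P = d%:Z -> has_extension P k ->
  exists N (s : 'I_N -> R),
    (N <= k * k)%N /\ (vertex_field P `<=` ratfun_values s)%classic.
Proof.
move=> dimP [m [Q [f [fQ <-]]]].
have [r [v Qv]] := polytope_setP Q.
have [S SM coverS] := facet_slack_matrix Qv.
move: (nb_facets Q) S SM coverS => {}k S SM coverS.
rewrite -fQ Qv conv_hull_image in dimP *.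
set v' := f \o v in dimP *; set M := (homog v)^T in SM coverS.
set M' := (homog v')^T.
have M'M : (M' <= M)%MS by exact: homog_image_sub.
have rkM' : \rank M' = d.+1.
  by rewrite mxrank_tr; move: dimP; rewrite affdim_conv_hull; lia.
have slack1 i : slack v 0 1 0 i = 1.
  by rewrite mxE big1 ?subr0 // => a _; rewrite mxE mul0r.
(* The constant functional 1 defines the empty face, on which every [h] vanishes vacuously. *)
have MS : (M <= S)%MS.
  apply/rV_subP => h hM.
  have [i|i|mu -> _] := face_facet_combination coverS (slack_sub v 0 1) _ hM.
  - by rewrite slack1 ler01.
  - by rewrite slack1 => /eqP; rewrite oner_eq0.
  - exact: submxMl.
have /submxP[A M'E] := submx_trans M'M MS.
pose B := row_base (kermx S).
have BS : B *m S = 0 by apply/sub_kermxP; rewrite eq_row_base.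
pose C := col_mx A B.
exists ((1 + d + \rank (kermx S)) * k)%N, (fun j => mxvec C 0 j).
set s := fun j => _; split.
  rewrite leq_mul2r mxrank_ker; apply/orP; right.
  have := mxrankS M'M; have := mxrankS MS; have := rank_leq_row S.
  by rewrite rkM'; lia.
have KC i j : C i j \in ratfun_pred s.
  rewrite inE; have -> : C i j = s (mxvec_index i j) by rewrite /s mxvecE.
  exact: ratfun_values_gen.
have KA i j : A i j \in ratfun_pred s by have := KC (lshift _ i) j; rewrite col_mxEu.
have KB i j : B i j \in ratfun_pred s by have := KC (rshift _ i) j; rewrite col_mxEd.
apply: smallest_sub; first exact: ratfun_values_divring.
move=> _ [x xP [a _] <-].
have [c [b [y_ge0 yx [i yi]]]] := vertex_slack xP.
have M'1 i' : M' (lshift d 0) i' = 1 by rewrite !mxE (unsplitK (inl _)) mxE.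
have M'a i' : M' (rshift 1 a) i' = v' i' 0 a by rewrite !mxE (unsplitK (inr _)).
have rowE0 : row (lshift d 0) A *m S = row (lshift d 0) M' by rewrite M'E row_mul.
have rowEa : row (rshift 1 a) A *m S = row (rshift 1 a) M' by rewrite M'E row_mul.
suff : x 0 a \in ratfun_pred s by rewrite inE.
(* Row [lshift d 0] of [A] represents the constant 1 and row [rshift 1 a] the coordinate [a] of [f].
   Read on [Q], [slack v' c b] is the slack vector of the face that [f] maps to [x]. *)
apply: (@face_value_subfield R _ k r _ S (row (lshift d 0) A)
  (row (rshift 1 a) A) B (slack v' c b) _ i) => //.
- by rewrite eq_row_base.
- by move=> j; rewrite mxE.
- by move=> j; rewrite mxE.
- rewrite rowE0 rowEa; apply: (face_facet_combination coverS) => //.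
  + by apply: submx_trans M'M; exact: slack_sub.
  + apply: submx_trans M'M; rewrite addmx_sub ?row_sub // eqmx_opp.
    by rewrite scalemx_sub // row_sub.
  + move=> i' /yx vx; rewrite mxE [X in _ + X]mxE [X in _ - X]mxE.
    by rewrite [row _ _ _ _]mxE M'a [row _ _ _ _]mxE M'1 vx mulr1 subrr.
- by rewrite rowE0 mxE.
- by rewrite rowEa mxE M'a yx.
Qed.

Theorem theorem5p1 (R : realType) (d : nat) (P : polytope R d) (g : nat)
    (dimP : affdim P = d%:Z) (trdegL : has_trdeg (vertex_field P) g) :
  Num.sqrt (g%:R : R) <= (xc P)%:R.
Proof.
rewrite /xc; case: ex_minnP => k /asboolP Pk _.
have [N [s [Nk Ls]]] := extension_vertex_field dimP Pk.
have [t [tL tindep _]] := trdegL.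
have gN := algebraically_independent_leq tindep (fun i => Ls _ (tL i)).
rewrite -[leRHS]ger0_norm // -sqrtr_sqr ler_wsqrtr // -natrX ler_nat.
by rewrite (leq_trans gN) // -mulnn.
Qed.
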